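(* Let $M$ be a connected compact manifold of dimension $m$, let $S$ be a triangulation of $M$ and $S^*$ the Poincaré dual cell decomposition. Let $p$ be a natural number such that $H_p(M,\mathbb{Z}_2)\neq 0$. Let $V_1=B_p$ be the space of $p$-boundaries and $V_2=Z_p^\perp$ the space orthogonal to the $p$-cycles, both regarded as subspaces of the $\mathbb{Z}_2$ $p$-chains of $S$. Then $V_1$ and $V_2$ define a CSS code, and this is a quantum error correcting code with parameters $[[n,k,d]]$, where $$n=|S_p|,\qquad k=\dim H_p(M,\mathbb{Z}_2),\qquad d=\min\{csys_p(M,S),\,csys_{m-p}(M,S^* )\}.$$
   Context: Manifolds are without boundary. $S_p$ is the set of $p$-simplices of $S$; the space $C_p$ of $p$-chains with $\mathbb{Z}_2$ coefficients has basis $S_p$ and is identified with $\mathbb{Z}_2^n$, $n=|S_p|$, with bilinear form $a\cdot b=\sum_i a_ib_i$ (which defines $\perp$). $Z_p=\ker(\partial_p)$ and $B_p=\operatorname{Im}(\partial_{p+1})$. The dual cell decomposition $S^*$ has its $(m-i)$-cells in bijection $*$ with the $i$-simplices of $S$, the induced isomorphisms of $\mathbb{Z}_2$-chain spaces carrying the boundary map to the coboundary map: $\delta( *\sigma)=*\partial\sigma$. For a cell structure $T$ on $M$ with $H_i(M,\mathbb{Z}_2)\ne 0$, the combinatorial systole $csys_i(M,T)$ is the minimal number of $i$-cells in the support of a cellular $i$-cycle of $T$ with $\mathbb{Z}_2$ coefficients that is not homologous to zero. CSS codes: for $a\in\mathbb{Z}_2^n$ let $X^a=X^{a_1}\otimes\cdots\otimes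 X^{a_n}$ and $Z^a=Z^{a_1}\otimes\cdots\otimes Z^{a_n}$ act on $(\mathbb{C}^2)^{\otimes n}$, where $X=\begin{pmatrix}0&1\\1&0\end{pmatrix}$ and $Z=\begin{pmatrix}1&0\\0&-1\end{pmatrix}$. For orthogonal subspaces $V_1,V_2\subseteq\mathbb{Z}_2^n$, the CSS code is the subspace of $(\mathbb{C}^2)^{\otimes n}$ of all vectors fixed by every $X^a$ ($a\in V_1$) and every $Z^b$ ($b\in V_2$). A quantum code with parameters $[[n,k,d]]$ is a $2^k$-dimensional subspace of $(\mathbb{C}^2)^{\otimes n}$ with distance $d$. Here, if $\{|\bar i\rangle\}$ is an orthonormal basis of the code space, the distance is the minimal weight of an operator $E\in\{X,Z,iY,I\}^{\otimes n}$ (with $iY=ZX$) for which there is no constant $C_E$ with $\langle\bar i|E|\bar j\rangle=C_E\,\delta_{ij}$ for all $i,j$. The weight of $E$ is the number of tensor factors that are not $I$. *)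

(* Defs.v *)
From HB Require Import structures.
From mathcomp Require Import all_boot all_order all_algebra.
From mathcomp Require Import complex.
From mathcomp Require Import all_classical all_reals all_analysis.

Set Implicit Arguments.
Unset Strict Implicit.
Unset Printing Implicit Defensive.

Import Order.TTheory GRing.Theory Num.Theory.
Import numFieldTopology.Exports numFieldNormedType.Exports.

Local Open Scope ring_scope.

(** * Topological manifolds and triangulations *)

Definition homeomorphic_via (X Y : topologicalType) (A : set X) (B : set Y)
    (f : X -> Y) (g : Y -> X) : Prop :=
  [/\ {homo f : x / A x >-> B x}, {homo g : y / B y >-> A y},
      ({within A, continuous f})%classic, ({within B, continuous g})%classic
    & (forall x, A x -> g (f x) = x) /\ (forall y, B y -> f (g y) = y)].

Record manifold (R : realType) (m : nat) (M : topologicalType) : Prop := {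
  manifold_hausdorff : hausdorff_space M;
  manifold_second_countable : @second_countable M;
  manifold_chart : forall x : M,
    exists (U : set M) (W : set 'rV[R]_m) (f : M -> 'rV[R]_m) (g : 'rV[R]_m -> M),
      [/\ open U, U x, open W & homeomorphic_via U W f g]
}.

(* The standard geometric realization of an abstract simplicial complex on the
   vertex set 'I_N: points of R^N are given by barycentric coordinates. *)
Definition realization (R : realType) (N : nat) (K : {set {set 'I_N}}) :
    set 'rV[R]_N :=
  fun x => [/\ forall v, 0 <= x 0 v, \sum_v x 0 v = 1
             & [set v | x 0 v != 0]%SET \in K].

Record triangulation (R : realType) (M : topologicalType) := Triangulation {
  nvert : nat;
  simplices : {set {set 'I_nvert}};
  simplices_neq0 : finset.set0 \notin simplices;
  simplices_face : forall s t : {set 'I_nvert},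
    t \in simplices -> s \subset t -> s != finset.set0 -> s \in simplices;
  tri : 'rV[R]_nvert -> M;
  tri_inv : M -> 'rV[R]_nvert;
  tri_homeo : homeomorphic_via (realization (R := R) simplices) [set: M]%classic
                tri tri_inv
}.

(** * Cell structures and Z_2-homology *)

(* A finite collection of closed cells in M.  Dimensions are integers so that
   the dimension m - i of a dual cell is never truncated. *)
Record cell_structure (M : topologicalType) := CellStructure {
  cell : finType;
  cdim : cell -> int;
  carrier : cell -> set M
}.

Definition simplicial_cells (R : realType) (M : topologicalType)
    (S : triangulation R M) : cell_structure M :=
  @CellStructure M {s : {set 'I_(nvert S)} | s \in simplices S}
    (fun s => #|val s|%:Z - 1)
    (fun s => (@tri R M S @` [set x | realization (R := R) (simplices S) x /\
                        [set v | x 0%R v != 0%R]%SET \subset val s])%classic).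

Definition barycenter (R : realType) (N : nat) (s : {set 'I_N}) : 'rV[R]_N :=
  \row_v (if v \in s then #|s|%:R^-1 else 0).

(* The block dual to s: the union of the simplices of the barycentric
   subdivision spanned by the barycenters of t_0 < ... < t_k with s <= t_0. *)
Definition dual_block (R : realType) (N : nat) (K : {set {set 'I_N}})
    (s : {set 'I_N}) : set 'rV[R]_N :=
  fun x => exists c : {ffun {set 'I_N} -> R},
    [/\ forall t, 0 <= c t,
        \sum_t c t = 1,
        forall t, c t != 0 -> (t \in K) /\ s \subset t,
        forall t u, c t != 0 -> c u != 0 -> (t \subset u) || (u \subset t)
      & x = \sum_t c t *: barycenter R t].

(* The Poincare dual decomposition; the bijection * is the identity on the
   underlying type of simplices. *)
Definition dual_cells (m : nat) (R : realType) (M : topologicalType)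
    (S : triangulation R M) : cell_structure M :=
  @CellStructure M {s : {set 'I_(nvert S)} | s \in simplices S}
    (fun s => m%:Z - (#|val s|%:Z - 1))
    (fun s => (@tri R M S @` dual_block (R := R) (simplices S) (val s))%classic).

(* The Z_2-vector space with basis I. *)
Notation chain I := {ffun I -> ('F_2)^o}.

Definition weight (I : finType) (c : chain I) : nat := #|[set x | c x != 0]%SET|.

Section Homology.
Variables (M : topologicalType) (T : cell_structure M).

Definition icell (i : int) : finType := {e : cell T | cdim e == i}.

Definition incident (i j : int) (e : icell i) (f : icell j) : bool :=
  (j + 1 == i) && `[< (carrier (val f) `<=` carrier (val e))%classic >].

(* The boundary of a cell is the sum of the cells of one dimension less that
   it contains; this is the mod 2 cellular boundary when the closed cells are
   embedded, as simplices and dual blocks are.  It is zero unless j = i - 1;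
   having both degrees as parameters avoids casts between C_(i+1-1) and C_i. *)
Definition boundary_fun (i j : int) (c : chain (icell i)) : chain (icell j) :=
  [ffun f => \sum_(e | incident e f) c e].

Fact boundary_fun_linear i j : linear (@boundary_fun i j).
Proof.
move=> a b c; apply/ffunP => f; rewrite !ffunE scaler_sumr -big_split /=.
by apply: eq_bigr => e _; rewrite !ffunE.
Qed.

HB.instance Definition _ i j :=
  GRing.isLinear.Build 'F_2 (chain (icell i)) (chain (icell j)) _
    (@boundary_fun i j) (@boundary_fun_linear i j).

Definition boundary i j : 'Hom(chain (icell i), chain (icell j)) :=
  linfun (@boundary_fun i j).

Definition cycles (i : int) : {vspace chain (icell i)} :=
  lker (boundary i (i - 1)).

Definition boundaries (i : int) : {vspace chain (icell i)} :=
  limg (boundary (i + 1) i).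

(* The quotient of cycles by boundaries, realized as a complement of the
   boundaries inside the cycles. *)
Definition homology (i : int) : {vspace chain (icell i)} :=
  (cycles i :\: boundaries i)%VS.

(* Meaningful when the i-th homology is nonzero.  The initial value #|icell i|
   bounds every weight, so it does not affect the minimum in that case. *)
Definition csys (i : int) : nat :=
  \big[minn/#|icell i|]_(c | (c \in cycles i) && (c \notin boundaries i))
    weight c.

End Homology.

(** * Quantum codes *)

Section Codes.
Variables (R : realType) (I : finType).

(* (C^2)^{\otimes n} with one tensor factor for each element of I, n = #|I|:
   a vector is given by its coordinates in the basis of tensor products of
   standard basis vectors, which is indexed by I -> {0, 1}. *)
Definition qstate := {ffun {ffun I -> 'I_2} -> R[i]^o}.

Definition pauliX : 'M[R[i]]_2 := \matrix_(r, s) (r != s)%:R.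
Definition pauliZ : 'M[R[i]]_2 := \matrix_(r, s) ((-1) ^+ r *+ (r == s)).

Definition tensor_fun (A : I -> 'M[R[i]]_2) (psi : qstate) : qstate :=
  [ffun x : {ffun I -> 'I_2} =>
     \sum_(y : {ffun I -> 'I_2}) (\prod_i A i (x i) (y i)) * psi y].

Fact tensor_fun_linear A : linear (tensor_fun A).
Proof.
move=> a f g; apply/ffunP => x; rewrite !ffunE scaler_sumr -big_split /=.
by apply: eq_bigr => y _; rewrite !ffunE mulrDr scalerAr.
Qed.

HB.instance Definition _ A :=
  GRing.isLinear.Build R[i] qstate qstate _ (tensor_fun A) (tensor_fun_linear A).

Definition tensor_op (A : I -> 'M[R[i]]_2) : 'End(qstate) :=
  linfun (tensor_fun A).

Definition opX (a : chain I) : 'End(qstate) :=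
  tensor_op (fun i => pauliX ^+ (a i : 'I_2)).
Definition opZ (b : chain I) : 'End(qstate) :=
  tensor_op (fun i => pauliZ ^+ (b i : 'I_2)).

Definition dot (a b : chain I) : 'F_2 := \sum_i a i * b i.

Definition orthogonal_spaces (V W : {vspace chain I}) : Prop :=
  forall a b, a \in V -> b \in W -> dot a b = 0.

Fact dot_linear a : linear (dot a : chain I -> ('F_2)^o).
Proof.
move=> k b c; rewrite /dot scaler_sumr -big_split /=.
by apply: eq_bigr => y _; rewrite !ffunE mulrDr scalerAr.
Qed.

HB.instance Definition _ a :=
  GRing.isLinear.Build 'F_2 (chain I) ('F_2)^o _
    (dot a : chain I -> ('F_2)^o) (dot_linear a).

Definition perp (V : {vspace chain I}) : {vspace chain I} :=
  (\bigcap_(a | a \in V) lker (linfun (dot a : chain I -> ('F_2)^o)))%VS.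

Definition css_code (V1 V2 : {vspace chain I}) : {vspace qstate} :=
  ((\bigcap_(a | a \in V1) fixedSpace (opX a)) :&:
   (\bigcap_(b | b \in V2) fixedSpace (opZ b)))%VS.

Definition inner (phi psi : qstate) : R[i] := \sum_x (phi x)^* * psi x.

Definition orthonormal_basis (Q : {vspace qstate}) (b : (\dim Q).-tuple qstate) :=
  basis_of Q b /\
  forall i j : 'I_(\dim Q), inner (tnth b i) (tnth b j) = (i == j)%:R.

(* A tensor product of operators in {X, Z, iY, I}, where iY = ZX. *)
Definition pauli_string (E : I -> 'M[R[i]]_2) : Prop :=
  forall i, E i \in [:: pauliX; pauliZ; pauliZ * pauliX; 1].

Definition op_weight (E : I -> 'M[R[i]]_2) : nat := #|[set i | E i != 1]%SET|.

Definition scalar_on (Q : {vspace qstate}) (b : (\dim Q).-tuple qstate)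
    (E : I -> 'M[R[i]]_2) : Prop :=
  exists C : R[i], forall i j : 'I_(\dim Q),
    inner (tnth b i) (tensor_op E (tnth b j)) = C * (i == j)%:R.

Definition code_distance (Q : {vspace qstate}) (d : nat) : Prop :=
  forall b : (\dim Q).-tuple qstate, orthonormal_basis b ->
    (exists E, [/\ pauli_string E, ~ scalar_on b E & op_weight E = d]) /\
    (forall E, pauli_string E -> ~ scalar_on b E -> (d <= op_weight E)%N).

Definition code_parameters (Q : {vspace qstate}) (n k d : nat) : Prop :=
  [/\ #|I| = n, \dim Q = (2 ^ k)%N & code_distance Q d].

End Codes.

(* Main.v *)
Require Import Defs.
From HB Require Import structures.
From mathcomp Require Import all_boot all_order all_algebra all_field.
From mathcomp Require Import complex zify.
From mathcomp Require Import all_classical all_reals all_analysis.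

(** Two independent facts combine.

    The first concerns an arbitrary pair of orthogonal subspaces [V1], [V2] of
    Z_2^n.  A vector of the CSS code is a function on Z_2^n that vanishes off
    [perp V2] (this is what the operators Z^b say) and is constant on the cosets
    of [V1] (this is what the operators X^a say).  So the code is the space of
    functions on [perp V2 / V1], of dimension 2^(dim perp V2 - dim V1)
    ([css_dim]).  Up to the order of the factors a Pauli string is Z^z X^x, and
    three cases occur.  If [z] is not in [perp V1] or [x] is not in [perp V2],
    the error moves the code to an orthogonal subspace and all its matrix
    elements vanish ([scalar_on_detected]).  If [z] is in [V2] and [x] is in
    [V1], the error fixes the code pointwise ([scalar_on_stabilizer]).
    Otherwise it is a nontrivial logical operator, and its weight is at least
    that of [x] and that of [z].  Conversely X^x with [x] in [perp V2] outside
    [V1], and Z^z with [z] in [perp V1] outside [V2], are never scalar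
    ([logical_X_not_scalar], [logical_Z_not_scalar]), as one sees on the uniform
    superpositions of cosets of [V1].  Hence the distance is the smaller of the
    least weights in [perp V2] outside [V1] and in [perp V1] outside [V2]
    ([css_code_parameters]).

    The second is that the dual decomposition turns the boundary into the
    coboundary.  For [V1 = B_p] and [V2 = perp Z_p], double orthogonality gives
    [perp V2 = Z_p], so the first minimum is the systole of the triangulation
    and the dimension is that of the homology.  The coboundary is the transpose
    of the boundary for the form [dot], so cocycles form [perp B_p] and
    coboundaries form [perp Z_p]; and a dual block lies in another exactly when
    the corresponding simplices are nested the other way ([sub_carrier_dual]).
    Therefore the cycles and boundaries of the dual cells in dimension [m - p]
    are [perp V1] and [V2] ([star_cycles], [star_boundaries]), and the second
    minimum is the systole of the dual decomposition ([csys_dual]). *)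

Set Implicit Arguments.
Unset Strict Implicit.
Unset Printing Implicit Defensive.

Import Order.TTheory GRing.Theory Num.Theory.

Local Open Scope ring_scope.

(** * Chains over the field with two elements *)

Lemma addF2 (x : 'F_2) : x + x = 0.
Proof. by case: x => [[|[|[]]] //= lt_x]; apply/val_inj. Qed.

Lemma F2_cases (x : 'F_2) : x = 0 \/ x = 1.
Proof.
by case: x => [[|[|[]]] //= lt_x]; [left | right]; apply/val_inj.
Qed.

Lemma F2_neq0 (x : 'F_2) : (x != 0) = (x == 1).
Proof. by case: (F2_cases x) => ->. Qed.

Section Chains.
Variable I : finType.
Implicit Types (a b c s : chain I) (U V W : {vspace chain I}).

Lemma addcc a : a + a = 0.
Proof. by apply/ffunP => i; rewrite !ffunE addF2. Qed.

Lemma addcK a : involutive (+%R^~ a).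
Proof. by move=> s; rewrite /= -addrA addcc addr0. Qed.

Lemma dotC a b : dot a b = dot b a.
Proof. by apply: eq_bigr => i _; rewrite mulrC. Qed.

Lemma dotDr a b c : dot a (b + c) = dot a b + dot a c.
Proof.
by rewrite /dot -big_split; apply: eq_bigr => i _; rewrite ffunE mulrDr.
Qed.

Lemma dot0r a : dot a 0 = 0.
Proof. by rewrite /dot big1 // => i _; rewrite ffunE mulr0. Qed.

Lemma dot0l a : dot 0 a = 0.
Proof. by rewrite dotC dot0r. Qed.

Definition delta (i : I) : chain I := [ffun j => (j == i)%:R].

Lemma dot_delta a i : dot a (delta i) = a i.
Proof.
rewrite /dot (bigD1 i) //= big1 ?addr0 ?ffunE ?eqxx ?mulr1 // => j /negPf ji.
by rewrite ffunE ji mulr0.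
Qed.

Lemma chain_sum_delta a : a = \sum_i a i *: delta i.
Proof.
apply/ffunP => j; rewrite sum_ffunE (bigD1 j) //= big1 ?addr0.
  by rewrite !ffunE eqxx; symmetry; apply: mulr1.
by move=> i ij; rewrite !ffunE eq_sym (negPf ij); apply: mulr0.
Qed.

Lemma memv_bigcapP {K : fieldType} {vT : vectType K} {J : finType} {P : pred J}
    {Us : J -> {vspace vT}} {u : vT} :
  reflect (forall j, P j -> u \in Us j) (u \in \bigcap_(j | P j) Us j)%VS.
Proof.
by rewrite memvE; apply: (iffP subv_bigcapP) => Uu j /Uu; rewrite -memvE.
Qed.

Lemma perpP V b : reflect (forall a, a \in V -> dot a b = 0) (b \in perp V).
Proof.
rewrite /perp; apply: (iffP memv_bigcapP) => Vb a aV.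
  by have := Vb a aV; rewrite memv_ker lfunE => /eqP.
by rewrite memv_ker lfunE; apply/eqP/Vb.
Qed.

Lemma notin_perp V b : b \notin perp V -> exists2 a, a \in V & dot a b = 1.
Proof.
move=> bV; case: (pickP [pred a | (a \in V) && (dot a b != 0)]) => /= [a|no].
  by case/andP=> aV; rewrite F2_neq0 => /eqP; exists a.
case/perpP: bV => a aV; apply/eqP; move/(_ a): no.
by rewrite /= aV => /negbFE.
Qed.

(** The functional [y |-> (y - projv V y) i] vanishes on [V]; some coordinate [i]
    makes it nonzero at [x].  Every functional is [dot] with the chain of its
    values on the standard basis. *)
Lemma separation V x : x \notin V -> exists2 b, b \in perp V & dot x b = 1.
Proof.
move=> xV; pose r (y : chain I) := y - projv V y.
have rV y : y \in V -> r y = 0 by move=> yV; rewrite /r projv_id // subrr.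
have [i ri] : exists i, r x i != 0.
  apply/existsP; apply: contraNT xV => /existsPn rx0.
  have/eqP -> : x == projv V x.
    rewrite -subr_eq0; apply/eqP/ffunP => i; rewrite [RHS]ffunE.
    by apply/eqP; move: (rx0 i); rewrite negbK.
  exact: memv_proj.
pose b : chain I := [ffun j => r (delta j) i].
have dotb y : dot y b = r y i.
  rewrite /r {2 3}(chain_sum_delta y) linear_sum -sumrB sum_ffunE.
  by apply: eq_bigr => j _; rewrite linearZ -scalerBr !ffunE.
exists b; last by rewrite dotb; apply/eqP; rewrite -F2_neq0.
by apply/perpP => a aV; rewrite dotb rV // ffunE.
Qed.

Lemma perpK V : perp (perp V) = V.
Proof.
apply/vspaceP => x; apply/idP/idP => [/perpP xVV|xV].
  apply: contraT => /separation [b bV xb].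
  by have := xVV b bV; rewrite dotC xb.
by apply/perpP => b /perpP/(_ x xV); rewrite dotC.
Qed.

Lemma perpS U V : (U <= V)%VS -> (perp V <= perp U)%VS.
Proof.
move=> /subvP UV; apply/subvP => b /perpP bV; apply/perpP => a /UV; exact: bV.
Qed.

Lemma card_vspace_chain V : #|V| = (2 ^ \dim V)%N.
Proof.
transitivity (#|'F_2| ^ \dim V)%N; last by rewrite card_Fp.
exact: (@card_vspace 'F_2 (chain I : finType) _ V).
Qed.

Lemma weight_le_card a : (weight a <= #|I|)%N.
Proof. by rewrite /weight max_card. Qed.

End Chains.

(** Transposition exchanges kernels and orthogonals of images; [f] and [g] are
    transposes of each other for the form [dot]. *)
Lemma perp_limg (I J : finType) (f : 'Hom(chain I, chain J))
    (g : 'Hom(chain J, chain I)) :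
  (forall a b, dot (f a) b = dot a (g b)) -> perp (limg f) = lker g.
Proof.
move=> fg; apply/vspaceP => b; rewrite memv_ker; apply/perpP/eqP => [b_f|gb0].
  apply/ffunP => i; rewrite -dot_delta dotC -fg b_f ?memv_img ?memvf //.
  by rewrite ffunE.
by move=> _ /memv_imgP[a _ ->]; rewrite fg gb0 dot0r.
Qed.

Lemma perp_lker (I J : finType) (f : 'Hom(chain I, chain J))
    (g : 'Hom(chain J, chain I)) :
  (forall a b, dot (f a) b = dot a (g b)) -> perp (lker f) = limg g.
Proof.
move=> fg; rewrite -(@perp_limg _ _ g f) ?perpK // => a b.
by rewrite dotC -fg dotC.
Qed.

Lemma bigminn_attained (T : finType) (P : pred T) (F : T -> nat) (n : nat)
    (x0 : T) :
  P x0 -> (forall x, P x -> (F x <= n)%N) ->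
  exists2 x, P x & F x = \big[minn/n]_(y | P y) F y.
Proof.
move=> Px0 Fn; rewrite -Order.NatOrder.minEnat (bigmin_eq_arg _ x0) //.
by case: arg_minP => // x Px _; exists x.
Qed.

Lemma bigminn_le (T : finType) (P : pred T) (F : T -> nat) (n : nat) x :
  P x -> (\big[minn/n]_(y | P y) F y <= F x)%N.
Proof.
by move=> Px; rewrite -Order.NatOrder.minEnat -leEnat; apply: bigmin_le_cond.
Qed.

(** * Pauli strings acting on states *)

Section Pauli.
Variables (R : realType) (I : finType).
Implicit Types (a b s v x z : chain I) (V : {vspace chain I}).
Implicit Types (phi psi : qstate R I).

(** The additive character of the field with two elements, with complex values. *)
Definition sgn (t : 'F_2) : R[i] := (-1) ^+ (t : nat).

Lemma sgn0 : sgn 0 = 1. Proof. by []. Qed.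
Lemma sgn1 : sgn 1 = -1. Proof. by []. Qed.

Lemma sgnD t u : sgn (t + u) = sgn t * sgn u.
Proof.
case: (F2_cases t) => ->; first by rewrite add0r sgn0 mul1r.
case: (F2_cases u) => ->; first by rewrite addr0 sgn0 mulr1.
by rewrite addF2 sgn0 sgn1 mulrNN mulr1.
Qed.

Lemma sgn_sum (f : I -> 'F_2) : sgn (\sum_i f i) = \prod_i sgn (f i).
Proof. exact: (big_morph sgn sgnD sgn0). Qed.

(** The four matrices 1, X, Z, ZX indexed by the exponents of Z and of X, so that
    a Pauli string becomes a pair of chains. *)
Definition pauli (z x : 'F_2) : 'M[R[i]]_2 :=
  pauliZ R ^+ (z : nat) * pauliX R ^+ (x : nat).

(** A row index is read as an element of the field with two elements: X shifts it
    and Z multiplies by the character.  This is possible since ['F_2] and ['I_2]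
    are convertible. *)
Lemma pauliE (z x r t : 'F_2) :
  pauli z x r t = sgn (z * r) * (t == r + x)%:R.
Proof.
rewrite /pauli.
case: (F2_cases z) => ->; case: (F2_cases x) => ->;
  rewrite ?expr0 ?expr1 ?mul1r ?mulr1 ?mul0r ?addr0;
  case: (F2_cases r) => ->; case: (F2_cases t) => ->;
  rewrite !mxE ?big_ord_recl ?big_ord0 ?mxE ?sgn0 ?sgn1 ?mul1r ?mulN1r //=;
  rewrite ?mulr0n ?mulr1n ?expr0 ?expr1 ?mulr0 ?mul0r ?mulr1 ?addr0 ?add0r ?oppr0 //.
Qed.

Lemma pauli_eq1 (z x : 'F_2) : (pauli z x == 1) = (z == 0) && (x == 0).
Proof.
apply/eqP/andP => [zx1|[/eqP-> /eqP->]]; last by rewrite /pauli !expr0 mulr1.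
have := congr1 (fun A : 'M[R[i]]_2 => A (0 : 'F_2) (0 : 'F_2)) zx1.
have := congr1 (fun A : 'M[R[i]]_2 => A (1 : 'F_2) (1 : 'F_2)) zx1.
rewrite !pauliE !mxE !eqxx add0r mulr1 mulr0 sgn0 mul1r.
case: (F2_cases x) => [->|->]; last first.
  by move=> _ /esym/eqP; rewrite oner_eq0.
case: (F2_cases z) => [->|->] //.
by rewrite addr0 eqxx mulr1 sgn1 => /eqP; rewrite eqNr oner_eq0.
Qed.

Lemma pauli_string_pauli (E : I -> 'M[R[i]]_2) : pauli_string E ->
  exists z x, E = fun i => pauli (z i) (x i).
Proof.
move=> Ep; have /choice[f Ef] : forall i, exists p, E i = pauli p.1 p.2.
  move=> i; have := Ep i; rewrite !inE => /or4P[] /eqP->.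
  - by exists (0, 1); rewrite /pauli expr0 expr1 mul1r.
  - by exists (1, 0); rewrite /pauli expr0 expr1 mulr1.
  - by exists (1, 1); rewrite /pauli !expr1.
  - by exists (0, 0); rewrite /pauli !expr0 mulr1.
exists [ffun i => (f i).1], [ffun i => (f i).2].
by apply/funext => i; rewrite !ffunE.
Qed.

Lemma pauli_pauli_string z x : pauli_string (fun i => pauli (z i) (x i)).
Proof.
move=> i; rewrite /pauli.
case: (F2_cases (z i)) => ->; case: (F2_cases (x i)) => ->;
  by rewrite ?expr0 ?expr1 ?mul1r ?mulr1 !inE eqxx ?orbT.
Qed.

Lemma tensor_pauliE z x psi s :
  tensor_op (fun i => pauli (z i) (x i)) psi s = sgn (dot z s) * psi (s + x).
Proof.
rewrite lfunE ffunE (bigD1 (s + x)) //= [X in _ + X]big1 ?addr0 => [|y ys].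
  congr (_ * _); rewrite /dot sgn_sum; apply: eq_bigr => i _.
  by rewrite pauliE ffunE eqxx mulr1.
have /existsP[i yi] : [exists i, y i != (s + x) i].
  apply: contraNT ys => /existsPn sy; apply/eqP/ffunP => i.
  by apply/eqP; move: (sy i); rewrite negbK.
rewrite (bigD1 i) //= pauliE; move: yi; rewrite ffunE => /negPf ->.
by rewrite mulr0 !mul0r.
Qed.

Lemma opXE a psi s : opX R a psi s = psi (s + a).
Proof.
rewrite -[RHS]mul1r -sgn0 -[X in sgn X](dot0l s) -tensor_pauliE /opX.
congr (tensor_op _ psi s); apply/funext => i.
by rewrite ffunE /pauli expr0 mul1r.
Qed.

Lemma opZE b psi s : opZ R b psi s = sgn (dot b s) * psi s.
Proof.
have := tensor_pauliE b 0 psi s; rewrite addr0 => <-; rewrite /opZ.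
congr (tensor_op _ psi s); apply/funext => i.
by rewrite ffunE /pauli expr0 mulr1.
Qed.

Lemma op_weight_pauli z x :
  op_weight (fun i => pauli (z i) (x i)) =
  #|[set i | (z i != 0) || (x i != 0)]%SET|.
Proof.
by apply: eq_card => i; rewrite !inE pauli_eq1 negb_and.
Qed.

Lemma op_weight_pauliX x :
  op_weight (fun i => pauli ((0 : chain I) i) (x i)) = weight x.
Proof.
by rewrite op_weight_pauli; apply: eq_card => i; rewrite !inE ffunE eqxx.
Qed.

Lemma op_weight_pauliZ z :
  op_weight (fun i => pauli (z i) ((0 : chain I) i)) = weight z.
Proof.
by rewrite op_weight_pauli; apply: eq_card => i; rewrite !inE ffunE eqxx orbF.
Qed.

Lemma weight_pauliX z x :
  (weight x <= op_weight (fun i => pauli (z i) (x i)))%N.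
Proof.
rewrite op_weight_pauli; apply: subset_leq_card; apply/fintype.subsetP => i.
by rewrite !inE orbC => ->.
Qed.

Lemma weight_pauliZ z x :
  (weight z <= op_weight (fun i => pauli (z i) (x i)))%N.
Proof.
rewrite op_weight_pauli; apply: subset_leq_card; apply/fintype.subsetP => i.
by rewrite !inE => ->.
Qed.

Lemma inner_sumr (J : finType) phi (k : J -> R[i]) (u : J -> qstate R I) :
  inner phi (\sum_j k j *: u j) = \sum_j k j * inner phi (u j).
Proof.
rewrite /inner (eq_bigr (fun s => \sum_j k j * ((phi s)^* * u j s))).
  by rewrite exchange_big; apply: eq_bigr => j _; rewrite mulr_sumr.
move=> s _; rewrite sum_ffunE mulr_sumr; apply: eq_bigr => j _.
by rewrite ffunE [_ *: _]/(_ * _) mulrCA.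
Qed.

Lemma inner_suml (J : finType) (k : J -> R[i]) (u : J -> qstate R I) psi :
  inner (\sum_j k j *: u j) psi = \sum_j (k j)^* * inner (u j) psi.
Proof.
rewrite /inner (eq_bigr (fun s => \sum_j (k j)^* * ((u j s)^* * psi s))).
  by rewrite exchange_big; apply: eq_bigr => j _; rewrite mulr_sumr.
move=> s _; rewrite sum_ffunE rmorph_sum mulr_suml; apply: eq_bigr => j _.
by rewrite ffunE [_ *: _]/(_ * _) rmorphM mulrA.
Qed.

(** Sesquilinearity spreads the condition from the vectors of an orthonormal basis
    to the whole code, where the coset states can serve as test vectors. *)
Lemma scalar_on_inner (Q : {vspace qstate R I})
    (b : (\dim Q).-tuple (qstate R I)) (E : I -> 'M[R[i]]_2) :
  orthonormal_basis b -> scalar_on b E ->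
  exists C, forall phi psi, phi \in Q -> psi \in Q ->
    inner phi (tensor_op E psi) = C * inner phi psi.
Proof.
case=> bQ bb [C bE]; exists C => phi psi /(coord_basis bQ)-> /(coord_basis bQ)->.
rewrite linear_sum !inner_suml mulr_sumr; apply: eq_bigr => i _.
rewrite mulrCA; congr (_ * _).
rewrite (eq_bigr (fun j => coord b j psi *: tensor_op E b`_j)); last first.
  by move=> j _; rewrite linearZ.
rewrite !inner_sumr mulr_sumr; apply: eq_bigr => j _.
by rewrite mulrCA -!tnth_nth bE bb.
Qed.

End Pauli.

(** * CSS codes *)

Lemma qstate_scaleE (R : realType) (I : finType) (k : R[i]) (psi : qstate R I) s :
  (k *: psi) s = k * psi s.
Proof. by rewrite ffunE. Qed.

Section CssCode.
Variables (R : realType) (I : finType) (V1 V2 : {vspace chain I}).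
Hypothesis V12 : orthogonal_spaces V1 V2.
Implicit Types (a b s v x z : chain I) (phi psi : qstate R I).

Let Q := css_code R V1 V2.

Lemma sub_perp : (V1 <= perp V2)%VS.
Proof.
by apply/subvP => a aV; apply/perpP => b bV; rewrite dotC; apply: V12.
Qed.

(** Evaluating [Z^b psi = psi] at [s] with [b . s = 1] gives [psi s = - psi s];
    such a [b] in [V2] exists exactly when [s] is not in [perp V2]. *)
Lemma mem_css_code psi : psi \in Q <->
  (forall a s, a \in V1 -> psi (s + a) = psi s) /\
  (forall s, s \notin perp V2 -> psi s = 0).
Proof.
rewrite /Q /css_code; split.
  case/memv_capP=> /memv_bigcapP X1 /memv_bigcapP Z2.
  split=> [a s /X1/fixedSpaceP|s /notin_perp[b /Z2/fixedSpaceP fix_b bs]].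
    by move=> {2}<-; rewrite opXE.
  have := congr1 (fun f : qstate R I => f s) fix_b.
  rewrite /= opZE bs sgn1 mulN1r => /esym/eqP.
  by rewrite -addr_eq0 -mulr2n -mulr_natl mulf_eq0 pnatr_eq0 /= => /eqP.
case=> X1 Z2; apply/memv_capP.
split; apply/memv_bigcapP => c cV; apply/fixedSpaceP/ffunP => s.
  by rewrite opXE X1.
rewrite opZE; case: (boolP (s \in perp V2)) => [/perpP->//|/Z2->].
  by rewrite sgn0 mul1r.
by rewrite mulr0.
Qed.

(** The unnormalized uniform superposition of the elements of the coset [v + V1]. *)
Definition coset_state v : qstate R I := [ffun s : chain I => (s + v \in V1)%:R].

Lemma coset_state_mem v : v \in perp V2 -> coset_state v \in Q.
Proof.
move=> vV; apply/mem_css_code; split=> [a s aV|s sV]; rewrite !ffunE.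
  by rewrite addrAC rpredDr.
case svV: (s + v \in V1) => //; case/negP: sV.
by rewrite -(addcK v s) rpredD // (subvP sub_perp).
Qed.

Lemma coset_state_norm v : inner (coset_state v) (coset_state v) = #|V1|%:R.
Proof.
rewrite /inner (reindex_inj (can_inj (addcK v))) /= -sum1_card natr_sum.
rewrite [RHS]big_mkcond; apply: eq_bigr => s _; rewrite !ffunE addcK.
by rewrite conjC_nat -natrM mulnb andbb; case: (s \in V1).
Qed.

Lemma card_V1_neq0 : #|V1|%:R != 0 :> R[i].
Proof. by rewrite card_vspace_chain pnatr_eq0 expn_eq0. Qed.

Lemma coset_state_orth v w : v + w \notin V1 ->
  inner (coset_state v) (coset_state w) = 0.
Proof.
move=> vw; rewrite /inner big1 // => s _; rewrite !ffunE conjC_nat -natrM mulnb.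
case: andP => // -[sv sw]; case/negP: vw.
have := rpredD sv sw; rewrite addrACA addcc add0r //.
Qed.

(** A code vector is determined by its values on a complement [H] of [V1] in
    [perp V2], which is a set of coset representatives, and these values are
    arbitrary: restriction to [H] is an isomorphism onto the functions on [H]. *)
Lemma css_dim : \dim Q = (2 ^ \dim (perp V2 :\: V1))%N.
Proof.
set H := (perp V2 :\: V1)%VS; pose Hs := {h : chain I | h \in H}.
have HV h : h \in H -> h \in perp V2 by apply/subvP/diffvSl.
pose rf (psi : qstate R I) : {ffun Hs -> R[i]^o} := [ffun h => psi (val h)].
have rf_lin : linear rf by move=> k f g; apply/ffunP => h; rewrite !ffunE.
pose rL := GRing.isLinear.Build _ _ _ _ rf rf_lin.
pose rlin : {linear qstate R I -> {ffun Hs -> R[i]^o}} := HB.pack rf rL.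
pose r := linfun rlin.
have rE psi h : r psi h = psi (val h) by rewrite lfunE ffunE.
have inj : (Q :&: lker r = 0)%VS.
  apply/eqP; rewrite -subv0; apply/subvP => psi /memv_capP[/mem_css_code[X1 Z2]].
  rewrite memv_ker memv0 => /eqP r0; apply/eqP/ffunP => s; rewrite [RHS]ffunE.
  case: (boolP (s \in perp V2)) => [sV|/Z2//].
  have: s \in (H + V1)%VS by rewrite addv_diff; apply: (subvP (addvSl _ _)).
  case/memv_addP => h hH [a aV ->]; rewrite X1 //.
  by rewrite -(rE psi (Sub h hH)) r0 ffunE.
rewrite -(limg_dim_eq inj); suff -> : (r @: Q = fullv)%VS.
  rewrite dimvf /dim /= muln1 card_sig -card_vspace_chain; exact: eq_card.
apply/eqP; rewrite eqEsubv subvf /=; apply/subvP => g _.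
(* Distinct elements of H lie in distinct cosets of V1, so the coset states
   interpolate the prescribed values. *)
apply/memv_imgP; exists (\sum_h g h *: coset_state (val h)).
  by apply: rpred_sum => h _; apply/rpredZ/coset_state_mem/HV/valP.
apply/ffunP => h; rewrite rE sum_ffunE (bigD1 h) //= big1 ?addr0.
  by rewrite !ffunE addcc rpred0; symmetry; apply: mulr1.
move=> h' h'h; rewrite !ffunE; case hV: (_ \in V1); last exact: mulr0.
have : val h + val h' \in (H :&: V1)%VS.
  by apply/memv_capP; split=> //; apply: rpredD; apply: valP.
rewrite capv_diff memv0 addr_eq0 => /eqP hh'; case/eqP: h'h; apply: val_inj.
by rewrite hh' -[LHS]addr0 -(addcc (- val h')) addrA subrr add0r.
Qed.

Notation pauli_op z x := (fun i => pauli R (z i) (x i)).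

Lemma scalar_on_stabilizer (b : (\dim Q).-tuple (qstate R I)) z x :
  orthonormal_basis b -> z \in V2 -> x \in V1 -> scalar_on b (pauli_op z x).
Proof.
case=> bQ bb zV xV; exists 1 => i j; rewrite mul1r -bb; congr inner.
have /mem_css_code[X1 Z2] : tnth b j \in Q.
  by apply: (basis_mem bQ); apply: mem_tnth.
apply/ffunP => s; rewrite tensor_pauliE X1 //.
case: (boolP (s \in perp V2)) => [/perpP->//|/Z2->].
  by rewrite sgn0 mul1r.
by rewrite mulr0.
Qed.

(** If [z . a = 1] for some [a] in [V1], the substitution [s |-> s + a] changes
    the sign of the matrix element.  If [x] is not in [perp V2], the error shifts
    the support of a code vector off [perp V2]. *)
Lemma scalar_on_detected (b : (\dim Q).-tuple (qstate R I)) z x :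
  orthonormal_basis b -> (z \notin perp V1) || (x \notin perp V2) ->
  scalar_on b (pauli_op z x).
Proof.
case=> bQ _ zx; exists 0 => i j; rewrite mul0r.
have bP k : (forall a s, a \in V1 -> tnth b k (s + a) = tnth b k s) /\
    (forall s, s \notin perp V2 -> tnth b k s = 0).
  by apply/mem_css_code; apply: (basis_mem bQ); apply: mem_tnth.
have [Xi Zi] := bP i; have [Xj Zj] := bP j.
case/orP: zx => [/notin_perp[a aV az]|xV].
  set c := inner _ _; have cN : c = - c.
    rewrite {1}/c /inner (reindex_inj (can_inj (addcK a))) /= -sumrN.
    apply: eq_bigr => s _; rewrite !tensor_pauliE dotDr sgnD [dot z a]dotC az.
    by rewrite sgn1 (Xi _ _ aV) addrAC (Xj _ _ aV) mulrN1 mulNr mulrN.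
  apply/eqP; move/eqP: cN.
  by rewrite -addr_eq0 -mulr2n -mulr_natl mulf_eq0 pnatr_eq0.
rewrite /inner big1 // => s _; rewrite tensor_pauliE.
case: (boolP (s \in perp V2)) => [sV|/Zi->]; last by rewrite conjC0 mul0r.
rewrite Zj ?mulr0 // addrC; apply: contra xV => xsV.
by rewrite -(addcK s x) rpredD.
Qed.

(** Such an X^x sends the state of [V1] to the orthogonal state of [x + V1], so
    the scalar could only be 0, yet the latter state is a nonzero code vector. *)
Lemma logical_X_not_scalar (b : (\dim Q).-tuple (qstate R I)) x :
  orthonormal_basis b -> x \in perp V2 -> x \notin V1 ->
  ~ scalar_on b (pauli_op (0 : chain I) x).
Proof.
move=> bQ xV xV1 /(scalar_on_inner bQ)[C CE].
have Ecoset v : tensor_op (pauli_op (0 : chain I) x) (coset_state v)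
    = coset_state (v + x).
  by apply/ffunP => s; rewrite tensor_pauliE dot0l sgn0 mul1r !ffunE addrA addrAC.
have mem0 := coset_state_mem (mem0v (perp V2)).
have := CE _ _ mem0 mem0.
rewrite Ecoset coset_state_norm coset_state_orth ?add0r //.
move/esym/eqP; rewrite mulf_eq0 (negPf card_V1_neq0) orbF => /eqP C0.
have := CE _ _ (coset_state_mem xV) mem0.
rewrite Ecoset add0r coset_state_norm C0 mul0r => /eqP.
by rewrite (negPf card_V1_neq0).
Qed.

(** Each coset state is an eigenvector of Z^z.  The eigenvalue is 1 on [V1], and -1
    on [v + V1] for a [v] in [perp V2] with [z . v = 1]; the latter exists since
    [z] is not in [V2 = perp (perp V2)]. *)
Lemma logical_Z_not_scalar (b : (\dim Q).-tuple (qstate R I)) z :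
  orthonormal_basis b -> z \in perp V1 -> z \notin V2 ->
  ~ scalar_on b (pauli_op z (0 : chain I)).
Proof.
move=> bQ zV zV2 /(scalar_on_inner bQ)[C CE].
have Ecoset v : tensor_op (pauli_op z (0 : chain I)) (coset_state v)
    = sgn R (dot z v) *: coset_state v.
  apply/ffunP => s; rewrite tensor_pauliE addr0 qstate_scaleE !ffunE.
  case svV: (s + v \in V1); last by rewrite !mulr0.
  rewrite -{1}(addcK v s) dotDr sgnD [dot z (s + v)]dotC.
  by move/perpP/(_ _ svV): zV => ->; rewrite sgn0 mul1r.
have norm v : v \in perp V2 -> sgn R (dot z v) = C.
  move=> vV; have vQ := coset_state_mem vV; have := CE _ _ vQ vQ.
  have -> : inner (coset_state v)
      (tensor_op (pauli_op z (0 : chain I)) (coset_state v)) =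
      sgn R (dot z v) * inner (coset_state v) (coset_state v).
    rewrite Ecoset /inner mulr_sumr; apply: eq_bigr => s _.
    by rewrite qstate_scaleE mulrCA.
  by rewrite coset_state_norm; apply: mulIf; apply: card_V1_neq0.
have [v vV zv] := separation zV2.
have := norm v vV; rewrite zv -(norm 0 (mem0v _)) dot0r sgn0 sgn1 => /eqP.
by rewrite eqNr oner_eq0.
Qed.

(** For [U] the cycles and [W] the boundaries this is, by definition, the
    combinatorial systole. *)
Definition min_weight (U W : {vspace chain I}) : nat :=
  \big[minn/#|I|]_(c | (c \in U) && (c \notin W)) weight c.

(** Double orthogonality makes [perp V1] exceed [V2] as soon as [perp V2] exceeds
    [V1], so both minima are attained by actual chains. *)
Theorem css_code_parameters : (perp V2 :\: V1)%VS != 0%VS ->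
  code_parameters Q #|I| (\dim (perp V2 :\: V1))
    (minn (min_weight (perp V2) V1) (min_weight (perp V1) V2)).
Proof.
rewrite diffv_eq0 => ns; split=> //; first exact: css_dim.
have attained (U W : {vspace chain I}) : ~~ (U <= W)%VS ->
    exists2 c, (c \in U) && (c \notin W) & weight c = min_weight U W.
  case/subvPn => c cU cW.
  by apply: (bigminn_attained (x0 := c)) => [|*]; rewrite ?cU ?weight_le_card.
have nz : ~~ (perp V1 <= V2)%VS.
  by apply: contra ns => /perpS; rewrite perpK.
move=> b bQ; split=> [|E].
  have [x /andP[xV xV1] wx] := attained _ _ ns.
  have [z /andP[zV zV2] wz] := attained _ _ nz.
  rewrite /minn; case: ifP => _.
    exists (pauli_op (0 : chain I) x).
    rewrite op_weight_pauliX; split=> //; first exact: pauli_pauli_string.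
    exact: logical_X_not_scalar.
  exists (pauli_op z (0 : chain I)).
  rewrite op_weight_pauliZ; split=> //; first exact: pauli_pauli_string.
  exact: logical_Z_not_scalar.
case/pauli_string_pauli=> z [x ->] nscal; rewrite geq_min.
have [zV xV] : z \in perp V1 /\ x \in perp V2.
  by apply/andP; apply: contra_notT nscal; rewrite negb_and;
    apply: scalar_on_detected.
case: (boolP (x \in V1)) => xV1; last first.
  by rewrite (leq_trans _ (weight_pauliX R z x)) // bigminn_le ?xV.
case: (boolP (z \in V2)) => zV2; last first.
  by rewrite orbC (leq_trans _ (weight_pauliZ R z x)) // bigminn_le ?zV.
by case: nscal; apply: scalar_on_stabilizer.
Qed.

End CssCode.

(** * Inclusions between simplices and between dual blocks *)

Section Carriers.
Variables (R : realType) (M : topologicalType) (S : triangulation R M).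
Let K := simplices S.
Implicit Types s t u : {set 'I_(nvert S)}.

Lemma simplex_card_gt0 s : s \in K -> (0 < #|s|)%N.
Proof.
move=> sK; rewrite card_gt0; apply: contraNneq (simplices_neq0 S) => <- //.
Qed.

Lemma barycenter_support s v : s \in K -> (barycenter R s 0 v != 0) = (v \in s).
Proof.
move=> sK; rewrite mxE; case: (v \in s); last by rewrite eqxx.
by rewrite invr_eq0 pnatr_eq0 -lt0n simplex_card_gt0.
Qed.

Lemma barycenter_realization s :
  s \in K -> realization K (barycenter R s).
Proof.
move=> sK; split=> [v||].
- by rewrite mxE; case: ifP => // _; rewrite invr_ge0 ler0n.
- rewrite (eq_bigr (fun v => if v \in s then #|s|%:R^-1 else 0)); last first.
    by move=> v _; rewrite mxE.
  rewrite -big_mkcond sumr_const -[_ *+ _]mulr_natl mulfV //.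
  by rewrite pnatr_eq0 -lt0n simplex_card_gt0.
have -> // : [set v | barycenter R s 0 v != 0]%SET = s.
by apply/setP => v; rewrite inE barycenter_support.
Qed.

Lemma tri_inj x y : realization K x -> realization K y ->
  @tri R M S x = @tri R M S y -> x = y.
Proof.
by case: (tri_homeo S) => _ _ _ _ [triK _] /triK{2}<- /triK{2}<- ->.
Qed.

(** Injectivity of the triangulation reduces inclusions of carriers in the manifold
    to inclusions in the geometric realization. *)
Lemma tri_image_sub (A B : set 'rV[R]_(nvert S)) x :
  (A `<=` realization K)%classic -> (B `<=` realization K)%classic ->
  (@tri R M S @` A `<=` @tri R M S @` B)%classic -> A x -> B x.
Proof.
move=> AK BK AB Ax; have [y By xy] := AB (@tri R M S x) (imageP (@tri R M S) Ax).
by rewrite -(tri_inj (BK y By) (AK x Ax) xy).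
Qed.

(** The barycenter of [f] lies in the simplex [e] only if [f] is a face of [e]. *)
Lemma sub_carrier_simplicial (e f : cell (simplicial_cells S)) :
  `[< (carrier f `<=` carrier e)%classic >] = (val f \subset val e).
Proof.
apply/asboolP/idP => [fe|fe].
  have fK := valP f; apply/fintype.subsetP => v vf.
  suff [_ /fintype.subsetP] : realization K (barycenter R (val f)) /\
      [set v | barycenter R (val f) 0 v != 0]%SET \subset val e.
    by apply; rewrite inE barycenter_support.
  apply: (tri_image_sub (B := [set x | realization K x /\
    [set v | x 0 v != 0]%SET \subset val e]%classic) _ _ fe); try by move=> x [].
  split; first exact: barycenter_realization.
  by apply/fintype.subsetP => w; rewrite inE barycenter_support.
move=> _ [x [xK xf] <-]; exists x => //; split=> //.
exact: fintype.subset_trans fe.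
Qed.

(** No cancellation can occur between nonnegative coordinates. *)
Lemma dual_block_support s (c : {ffun {set 'I_(nvert S)} -> R}) v :
  (forall t, 0 <= c t) -> (forall t, c t != 0 -> t \in K) ->
  ((\sum_t c t *: barycenter R t) 0 v != 0) = [exists t, (c t != 0) && (v \in t)].
Proof.
move=> c0 cK; rewrite summxE psumr_neq0; last first.
  move=> t _; rewrite !mxE; apply: mulr_ge0; first exact: c0.
  by case: ifP => // _; rewrite invr_ge0 ler0n.
apply/hasP/existsP => -[t].
  move=> _ /= /lt0r_neq0; rewrite !mxE mulf_eq0 negb_or => /andP[ct].
  by case: ifP => [vt _|]; [exists t; rewrite ct vt | rewrite eqxx].
case/andP=> ct vt; exists t; rewrite ?mem_index_enum //= !mxE vt.
rewrite mulr_gt0 ?invr_gt0 ?ltr0n ?(simplex_card_gt0 (cK _ ct)) //.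
by rewrite lt_neqAle eq_sym ct c0.
Qed.

(** The simplices carrying the barycentric weights are totally ordered by
    inclusion, so the support of the point is the largest of them. *)
Lemma dual_block_realization s : (dual_block K s `<=` @realization R _ K)%classic.
Proof.
move=> x [c [c0 c1 cK cc ->]].
have cK' t : c t != 0 -> t \in K by case/cK.
split=> [v||].
- rewrite summxE; apply: sumr_ge0 => t _; rewrite !mxE mulr_ge0 ?c0 //.
  by case: ifP => // _; rewrite invr_ge0 ler0n.
- under eq_bigr do rewrite summxE.
  rewrite exchange_big -[RHS]c1; apply: eq_bigr => t _ /=.
  case: (eqVneq (c t) 0) => [->|/cK'/barycenter_realization[_ bt1 _]].
    by rewrite big1 // => v _; rewrite mxE mul0r.
  rewrite -[RHS]mulr1 -bt1 mulr_sumr; apply: eq_bigr => v _.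
  by rewrite [LHS]mxE.
have [t0 ct0] : exists t, c t != 0.
  apply/existsP; apply: contraT => /existsPn ct0.
  have := oner_neq0 R; rewrite -c1 big1 ?eqxx // => t _.
  by apply/eqP; move: (ct0 t); rewrite negbK.
have [t ct tmax] : exists2 t, c t != 0 & forall u, c u != 0 -> u \subset t.
  case: (@arg_maxnP _ t0 (fun t => c t != 0) (fun t => #|t|) ct0) => t ct tmax.
  exists t => // u cu; case/orP: (cc t u ct cu) => // tu.
  by have /eqP-> : t == u by rewrite eqEcard tu; apply: tmax.
suff -> // : [set v | (\sum_t c t *: barycenter R t) 0 v != 0]%SET = t.
  exact: cK'.
apply/setP => v; rewrite inE dual_block_support //; apply/existsP/idP => [[u]|vt].
  by case/andP=> /tmax/fintype.subsetP; apply.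
by exists t; rewrite ct.
Qed.

(** A simplex [u] carrying weight in a decomposition of the barycenter of [t] along
    the block of [s] contains [s] and lies in the support [t] of that point. *)
Lemma barycenter_dual_block s t : s \in K -> t \in K ->
  dual_block K s (barycenter R t) <-> s \subset t.
Proof.
move=> sK tK; split=> [[c [c0 c1 cK cc bt]]|st].
  have cK' u : c u != 0 -> u \in K by case/cK.
  have [u cu] : exists u, c u != 0.
    apply/existsP; apply: contraT => /existsPn ct0.
    have := oner_neq0 R; rewrite -c1 big1 ?eqxx // => u _.
    by apply/eqP; move: (ct0 u); rewrite negbK.
  have [_ su] := cK u cu; apply: (fintype.subset_trans su).
  apply/fintype.subsetP => v vu; rewrite -barycenter_support // bt.
  by rewrite dual_block_support //; apply/existsP; exists u; rewrite cu.
exists [ffun u => (u == t)%:R]; split.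
- by move=> u; rewrite ffunE ler0n.
- rewrite (bigD1 t) //= ffunE eqxx big1 ?addr0 // => u /negPf ut.
  by rewrite ffunE ut.
- by move=> u; rewrite ffunE; case: (eqVneq u t) => [->|]; rewrite ?eqxx.
- move=> u w; rewrite !ffunE; case: (eqVneq u t) => [->|]; rewrite ?eqxx //.
  by case: (eqVneq w t) => [->|]; rewrite ?eqxx // fintype.subxx.
rewrite (bigD1 t) //= ffunE eqxx scale1r big1 ?addr0 // => u /negPf ut.
by rewrite ffunE ut scale0r.
Qed.

Lemma sub_carrier_dual m (e f : cell (dual_cells m S)) :
  `[< (carrier f `<=` carrier e)%classic >] = (val e \subset val f).
Proof.
have eK := valP e; have fK := valP f.
apply/asboolP/idP => [fe|ef].
  apply/barycenter_dual_block => //.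
  apply: (tri_image_sub _ _ fe); try exact: dual_block_realization.
  exact/barycenter_dual_block.
apply: image_subset => x [c [c0 c1 cK cc xE]]; exists c; split=> // t ct.
by have [tK ft] := cK t ct; split=> //; apply: fintype.subset_trans ft.
Qed.

End Carriers.

(** * The coboundary as the transpose of the boundary *)

Section Coboundary.
Variables (M : topologicalType) (T : cell_structure M).

Definition coboundary_fun j i (d : chain (icell T j)) : chain (icell T i) :=
  [ffun e => \sum_(f | incident e f) d f].

Fact coboundary_fun_linear j i : linear (@coboundary_fun j i).
Proof.
move=> a b c; apply/ffunP => e; rewrite !ffunE scaler_sumr -big_split /=.
by apply: eq_bigr => f _; rewrite !ffunE.
Qed.

HB.instance Definition _ j i :=
  GRing.isLinear.Build 'F_2 (chain (icell T j)) (chain (icell T i)) _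
    (@coboundary_fun j i) (@coboundary_fun_linear j i).

Definition coboundary j i : 'Hom(chain (icell T j), chain (icell T i)) :=
  linfun (@coboundary_fun j i).

Lemma dot_boundary i j c d :
  dot (boundary T i j c) d = dot c (coboundary j i d).
Proof.
rewrite !lfunE /dot; under eq_bigr do rewrite ffunE mulr_suml.
under [RHS]eq_bigr do rewrite ffunE mulr_sumr.
by rewrite (exchange_big_dep xpredT).
Qed.

Lemma perp_boundaries i : perp (boundaries T i) = lker (coboundary i (i + 1)).
Proof. exact/perp_limg/dot_boundary. Qed.

Lemma perp_cycles i : perp (cycles T i) = limg (coboundary (i - 1) i).
Proof. exact/perp_lker/dot_boundary. Qed.

End Coboundary.

(** * The dual cell decomposition *)

Section SimplicialHomology.
Variables (R : realType) (M : topologicalType) (S : triangulation R M).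
Let T := simplicial_cells S.
Local Notation simplex e := (val (val e)).

Lemma simplex_card i (e : icell T i) : #|simplex e|%:Z = i + 1.
Proof. by apply/eqP; rewrite -subr_eq; apply: (valP e). Qed.

Lemma incident_simplicial i j (e : icell T i) (f : icell T j) :
  incident e f = (j + 1 == i) && (simplex f \subset simplex e).
Proof. by rewrite /incident sub_carrier_simplicial. Qed.

Lemma card_between (V : finType) (s t : {set V}) :
  #|t| = #|s|.+2 -> s \subset t ->
  #|[set u : {set V} | [&& s \subset u, u \subset t & #|u| == #|s|.+1]]%SET| = 2.
Proof.
move=> ts st; have ts2 : #|(t :\: s)%SET| = 2.
  by rewrite cardsD (finset.setIidPr st) ts subSn // subSnn.
rewrite -ts2 -[RHS](card_in_imset (f := fun v => (v |: s)%SET)).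
  apply: eq_card => u; rewrite inE; apply/and3P/imsetP => [[su ut us]|[v vts ->]].
    have /eqP/cards1P[v uv] : #|(u :\: s)%SET| = 1.
      by rewrite cardsD (finset.setIidPr su) (eqP us) subSnn.
    exists v.
      have : v \in (u :\: s)%SET by rewrite uv set11.
      by rewrite !inE => /andP[-> /(fintype.subsetP ut)].
    by rewrite -uv finset.setUC -{1}(finset.setID u s) (finset.setIidPr su).
  move: vts; rewrite inE => /andP[vs vt]; split.
  - exact: finset.subsetUr.
  - by rewrite finset.subUset finset.sub1set vt.
  - by rewrite cardsU1 vs.
move=> v w; rewrite !inE => /andP[vs _] /andP[ws _] /setP/(_ v).
by rewrite !inE eqxx (negPf vs) !orbF => /esym/eqP.
Qed.

(** Between a simplex and a face of codimension two there are exactly two simplices,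
    and two is zero. *)
Lemma boundary_boundary (i j k : int) c : k + 1 = j -> j + 1 = i ->
  boundary T j k (boundary T i j c) = 0.
Proof.
move=> kj ji; apply/ffunP => f; rewrite !lfunE !ffunE.
under eq_bigr do rewrite ffunE.
rewrite (exchange_big_dep xpredT) // big1 // => g _; rewrite sumr_const.
have cg := simplex_card g; have cf := simplex_card f.
have cgf : #|simplex g| = #|simplex f|.+2.
  by move: cg cf; move: #|simplex g| #|simplex f| => a b; lia.
case: (boolP (simplex f \subset simplex g)) => fg; last first.
  rewrite eq_card0 // => e; rewrite [RHS]inE; apply: contraNF fg.
  rewrite unfold_in !incident_simplicial => /andP[/andP[_ fe] /andP[_ eg]].
  exact: fintype.subset_trans eg.
suff -> : #|(fun e : icell T j => incident e f && incident g e)| = 2.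
  by rewrite mulr2n; apply: addF2.
rewrite -(card_between cgf fg).
have inj : injective (fun e : icell T j => simplex e).
  exact: inj_comp val_inj val_inj.
rewrite -(card_imset _ inj); apply: eq_card => u; rewrite inE.
apply/imsetP/and3P => [[e]|[fu ug uc]].
  rewrite unfold_in !incident_simplicial => /andP[/andP[_ fe] /andP[_ eg]] ->.
  split=> //; rewrite -eqz_nat simplex_card; lia.
have u0 : u != finset.set0 by rewrite -card_gt0 (eqP uc).
have uK := simplices_face (valP (val g)) ug u0.
have uj : @cdim M T (exist _ u uK) == j.
  by rewrite /= (eqP uc); move: cf; lia.
exists (exist _ (exist _ u uK) uj) => //.
by rewrite unfold_in !incident_simplicial /= fu ug kj ji !eqxx.
Qed.

Lemma boundaries_sub_cycles i : (boundaries T i <= cycles T i)%VS.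
Proof.
apply/subvP => _ /memv_imgP[c _ ->]; rewrite memv_ker.
by rewrite boundary_boundary // subrK.
Qed.

Variable m : nat.
Let T' := dual_cells m S.

Fact dual_dim i j (ij : i + j = m%:Z) (e : icell T i) : @cdim M T' (val e) == j.
Proof. by have /eqP := valP e; rewrite /= => ->; rewrite -ij addrAC subrr add0r. Qed.

Fact primal_dim i j (ij : i + j = m%:Z) (e : icell T' j) : @cdim M T (val e) == i.
Proof.
have /eqP := valP e; rewrite /= => ej; apply/eqP; lia.
Qed.

(** Degrees are linked by a proof of [i + j = m], so that a dual degree may have
    any form ([m - p + 1] as well as [m - (p - 1)]) without casts. *)
Definition star i j (ij : i + j = m%:Z) (e : icell T i) : icell T' j :=
  exist _ (val e) (dual_dim ij e).

Definition unstar i j (ij : i + j = m%:Z) (e : icell T' j) : icell T i :=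
  exist _ (val e) (primal_dim ij e).

Lemma starK i j (ij : i + j = m%:Z) : cancel (star ij) (unstar ij).
Proof. by move=> e; apply: val_inj. Qed.

Lemma unstarK i j (ij : i + j = m%:Z) : cancel (unstar ij) (star ij).
Proof. by move=> e; apply: val_inj. Qed.

Lemma incident_star i j i' j' (ij : i + j = m%:Z) (ij' : i' + j' = m%:Z)
    (e : icell T i) (f : icell T i') :
  incident (star ij' f) (star ij e) = incident e f.
Proof.
rewrite incident_simplicial /incident sub_carrier_dual /=.
by congr (_ && _); apply/eqP/eqP; lia.
Qed.

(** Pulling back along [star] is the inverse of the isomorphism * of chain spaces,
    going from dual chains to simplicial ones. *)
Definition star_chain i j (ij : i + j = m%:Z) (c : chain (icell T' j)) :
  chain (icell T i) := [ffun e => c (star ij e)].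

Definition unstar_chain i j (ij : i + j = m%:Z) (c : chain (icell T i)) :
  chain (icell T' j) := [ffun e => c (unstar ij e)].

Lemma star_chainK i j (ij : i + j = m%:Z) :
  cancel (star_chain ij) (unstar_chain ij).
Proof. by move=> c; apply/ffunP => e; rewrite !ffunE unstarK. Qed.

Lemma unstar_chainK i j (ij : i + j = m%:Z) :
  cancel (unstar_chain ij) (star_chain ij).
Proof. by move=> c; apply/ffunP => e; rewrite !ffunE starK. Qed.

Lemma star_boundary i j i' j' (ij : i + j = m%:Z) (ij' : i' + j' = m%:Z) c :
  star_chain ij (boundary T' j' j c) = coboundary T i' i (star_chain ij' c).
Proof.
apply/ffunP => e; rewrite ffunE !lfunE !ffunE.
rewrite (reindex (star ij')) /=; last first.
  by exists (unstar ij') => f _; [exact: starK | exact: unstarK].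
by apply: eq_big => [f|f _]; rewrite ?incident_star ?ffunE.
Qed.

Lemma star_cycles i j (ij : i + j = m%:Z) c :
  (c \in cycles T' j) = (star_chain ij c \in perp (boundaries T i)).
Proof.
have ij' : i + 1 + (j - 1) = m%:Z by rewrite -ij; lia.
rewrite perp_boundaries !memv_ker -(star_boundary ij' ij).
rewrite -(can_eq (star_chainK ij')); congr (_ == _).
by apply/ffunP => e; rewrite !ffunE.
Qed.

Lemma star_boundaries i j (ij : i + j = m%:Z) c :
  (c \in boundaries T' j) = (star_chain ij c \in perp (cycles T i)).
Proof.
have ij' : i - 1 + (j + 1) = m%:Z by rewrite -ij; lia.
rewrite perp_cycles; apply/memv_imgP/memv_imgP => -[d _ dE].
  by exists (star_chain ij' d); rewrite ?memvf // dE (star_boundary _ ij').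
exists (unstar_chain ij' d); rewrite ?memvf //; apply: (can_inj (star_chainK ij)).
by rewrite (star_boundary _ ij') unstar_chainK.
Qed.

Lemma csys_dual i j (ij : i + j = m%:Z) :
  csys T' j = min_weight (perp (boundaries T i)) (perp (cycles T i)).
Proof.
have cardE : #|icell T' j| = #|icell T i|.
  by apply: (bij_eq_card (f := unstar ij)); exists (star ij);
    [exact: unstarK | exact: starK].
rewrite /csys /min_weight cardE -Order.NatOrder.minEnat.
rewrite [RHS](reindex (star_chain ij)) /=; last first.
  by exists (unstar_chain ij) => c _; [exact: star_chainK | exact: unstar_chainK].
apply: eq_big => [c|c _]; first by rewrite (star_cycles ij) (star_boundaries ij).
rewrite /weight -(card_imset _ (can_inj (unstarK ij))).
apply: eq_card => e; rewrite !inE ffunE; apply/imsetP/idP => [[f]|ce].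
  by rewrite inE => cf ->; rewrite unstarK.
by exists (star ij e); rewrite ?inE ?starK.
Qed.

End SimplicialHomology.

Theorem theorem0p2 (R : realType) (m : nat) (M : topologicalType)
    (hM : manifold R m M) (hcpt : compact [set: M]%classic)
    (hconn : connected [set: M]%classic)
    (S : triangulation R M) (p : nat)
    (hp : homology (simplicial_cells S) p%:Z != 0%VS) :
  let V1 := boundaries (simplicial_cells S) p%:Z in
  let V2 := perp (cycles (simplicial_cells S) p%:Z) in
  orthogonal_spaces V1 V2 /\
  code_parameters (css_code R V1 V2)
    #|icell (simplicial_cells S) p%:Z|
    (\dim (homology (simplicial_cells S) p%:Z))
    (minn (csys (simplicial_cells S) p%:Z)
          (csys (dual_cells m S) (m%:Z - p%:Z))).
Proof.
move=> V1 V2.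
have V12 : orthogonal_spaces V1 V2.
  move=> a b /(subvP (boundaries_sub_cycles S p%:Z)) aZ /perpP; exact.
have pm : p%:Z + (m%:Z - p%:Z) = m%:Z by rewrite addrCA subrr addr0.
split=> //; have := css_code_parameters R V12.
by rewrite perpK (csys_dual S pm); apply.
Qed.
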